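(* Let $n\ge 1$, $\lambda=(n,n-1,\ldots,1)$ (with $\lambda_{n+1}=0$), let $GZ^C_\lambda$ be the symplectic Gelfand--Zetlin polytope, $v$ its symplectic Kogan vertex, and $F\subset GZ^C_\lambda$ a symplectic Kogan face with diagram $D(F)$. (1) Let $i\in\{1,\ldots,n-1\}$. If $D(F)$ has $+$ in cell $(1,i)$ and no $+$ in any of the cells $(2k+1,i-k+1)$ and $(2k,i-k)$ (for all $k$ for which these cells exist), then $\mathcal M^v_i(F)$ consists of the symplectic Kogan faces whose diagrams are obtained from $D(F)$ by applying $M^C_{n-i+1}$. (2) If $D(F)$ has $+$ in cell $(1,n)$ and no $+$ in any of the cells $(2k,n-k)$, then $\mathcal M^v_n(F)$ consists of the symplectic Kogan faces whose diagrams are obtained from $D(F)$ by applying $M^C_1$.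
   Context: Put $\lambda_j=n+1-j$ for $j=1,\ldots,n+1$ (so $\lambda_{n+1}=0$) and $d=n^2$. A GZ table of type $C_n$ has rows $r=1,\ldots,2n-1$: row $2k-1$ has $n-k+1$ cells and row $2k$ has $n-k$ cells; cell $(r,m)$ is the $m$-th cell of row $r$ counted from the left. Coordinates on $\mathbb R^d$ are $y^r_m$, one per cell. Set $y^0_m:=\lambda_m$ ($m=1,\ldots,n+1$) and $y^{2k}_{n-k+1}:=0$ for $k=1,\ldots,n-1$. $GZ^C_\lambda$ is defined by the $2d$ inequalities $y^{r-1}_m\ge y^r_m\ge y^{r-1}_{m+1}$ for all cells $(r,m)$. Write $A_{r,m}$ for $y^{r-1}_m=y^r_m$ and $B_{r,m}$ for $y^r_m=y^{r-1}_{m+1}$. The symplectic Kogan vertex $v$ is the point of $GZ^C_\lambda$ satisfying $A_{r,m}$ for all cells with $r$ odd and $B_{r,m}$ for all cells with $r$ even. A symplectic Kogan face is a face of $GZ^C_\lambda$ containing $v$; its diagram $D(F)$ is the type $C_n$ GZ table with $+$ in cell $(r,m)$ iff $F$ satisfies the equation ($A_{r,m}$ if $r$ odd, $B_{r,m}$ if $r$ even) that $v$ satisfies at that cell. Geometric mitosis: for a polytope $\Delta$, faces $P,Q$ of $\Delta$ and a vertex $v\in P$, a face $F\subset P$ is admissible if there is a unique face $\exp(F)\ne F$ of $\Delta$ with $\exp(F)\cap P=F$; for admissible $F\ni v$, its mitosis is the set of faces $E$ of $\Delta$ with $v\in E$, $\dim E=\dim F+1$, $E\not\subset P$, $E\not\subset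 Q$, $E\cap Q\subseteq\exp(F)\cap Q$. $\mathcal M^v_i$ ($1\le i\le n$) is this operation for $\Delta=GZ^C_\lambda$, $P=\{y^1_i=\lambda_i\}\cap GZ^C_\lambda$, $Q=\{y^1_i=\lambda_{i+1}\}\cap GZ^C_\lambda$. Two-row mitosis: given two ordered lists of cells $a_1,\ldots,a_{\ell+1}$ and $b_1,\ldots,b_\ell$ of a table $D$ filled with $+$'s: if $a_1$ is empty the result is $\varnothing$; otherwise let $r$ be maximal with $a_1,\ldots,a_r$ all containing $+$, $\mathcal J=\{j\le r: b_j\text{ empty or }j=\ell+1\}$, and for $p\in\mathcal J$ let $D_p$ be obtained by erasing the $+$ in $a_p$ and moving the $+$ from $a_j$ to $b_j$ for all $j\in\mathcal J$, $j<p$ (other cells unchanged); the result is $\{D_p:p\in\mathcal J\}$. $M^C_1$ is two-row mitosis with $\ell=n-1$, $a_k=(2k-1,n-k+1)$ for $k=1,\ldots,n$, $b_k=(2k,n-k)$ for $k=1,\ldots,n-1$. For $i\in\{1,\ldots,n-1\}$, $M^C_{n-i+1}$ is two-row mitosis with $\ell=2i-1$, $a_{2k-1}=(2k-1,i-k+1)$, $a_{2k}=(2k,i-k+1)$ for $k=1,\ldots,i$, and $b_{2k-1}=(2k-1,i-k+2)$ for $k=1,\ldots,i$, $b_{2k}=(2k,i-k)$ for $k=1,\ldots,i-1$. (These are the paper's mitosis operations on skew pipe dreams, transported to GZ tables of type $C_n$ via the paper's bijection.) *)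

(* Defs.v *)
From HB Require Import structures.
From mathcomp Require Import all_boot all_order all_algebra.
From mathcomp Require Import all_classical reals.
From mathcomp Require Import zify.

Set Implicit Arguments.
Unset Strict Implicit.
Unset Printing Implicit Defensive.

Import Order.TTheory GRing.Theory Num.Theory.

Local Open Scope classical_set_scope.
Local Open Scope ring_scope.

Section Polytopes.
Variables (R : realType) (V : vectType R).
Implicit Types (Delta P Q E F G : set V) (v : V).

(* The zero functional gives the improper faces Delta and set0. *)
Definition is_face Delta F : Prop :=
  exists (f : {scalar V}) (b : R),
    (forall x, Delta x -> f x <= b) /\ F = Delta `&` [set x | f x = b].

Definition has_aff_indep F (k : nat) : Prop :=
  exists (x0 : V) (s : seq V),
    [/\ F x0, (forall x, x \in s -> F x), size s = k
      & free [seq x - x0 | x <- s]].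

(* The affine dimension of F: the largest k such that F contains k + 1 affinely
   independent points; meaningful only for nonempty F (its value on set0 is 0). *)
Definition face_dim F : nat :=
  \max_(k < (\dim {:V}).+1 | `[< has_aff_indep F k >]) k.

Definition is_exp Delta P F G : Prop :=
  [/\ is_face Delta G, G <> F & G `&` P = F].

Definition admissible Delta P F : Prop :=
  [/\ is_face Delta F, F `<=` P & exists! G, is_exp Delta P F G].

(* Only meant for admissible F, where G below is the unique face exp(F). *)
Definition geom_mitosis Delta P Q v F : set (set V) :=
  [set E | exists2 G, is_exp Delta P F G &
    [/\ is_face Delta E /\ E v, face_dim E = (face_dim F).+1,
        ~ (E `<=` P), ~ (E `<=` Q) & E `&` Q `<=` G `&` Q]].

End Polytopes.

(* Rows 2k-1 and 2k of the table have n-k+1 and n-k cells, i.e. row r has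
   n - r./2 cells; rows and columns are numbered from 1. *)
Definition gz_cells (n : nat) : seq (nat * nat) :=
  [seq (r, m) | r <- iota 1 (n.*2 - 1)%N, m <- iota 1 (n - r./2)%N].

Definition gz_cell (n : nat) : finType := seq_sub (gz_cells n).

Definition gz_space (R : realType) (n : nat) : vectType R :=
  {ffun gz_cell n -> R^o}.

Section GZ.
Variables (R : realType) (n : nat).
Implicit Types (y v : gz_space R n) (F : set (gz_space R n)).

Definition lam (j : nat) : R := (n.+1 - j)%:R.

(* y^r_m, extended by y^0_m = lam m; the default 0 covers the convention
   y^(2k)_(n-k+1) = 0, the only other non-cell indices ever used. *)
Definition gz_coord y (r m : nat) : R :=
  if r == 0%N then lam m
  else oapp (y : {ffun gz_cell n -> R^o}) 0 (insub (r, m)).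

Definition eqnA y (r m : nat) : Prop := gz_coord y r.-1 m = gz_coord y r m.
Definition eqnB y (r m : nat) : Prop := gz_coord y r m = gz_coord y r.-1 m.+1.

Definition GZC : set (gz_space R n) :=
  [set y | forall r m, (r, m) \in gz_cells n ->
     gz_coord y r.-1 m >= gz_coord y r m /\
     gz_coord y r m >= gz_coord y r.-1 m.+1].

Definition kogan_eqn y (r m : nat) : Prop :=
  if odd r then eqnA y r m else eqnB y r m.

Definition kogan_vertex v : Prop :=
  GZC v /\ forall r m, (r, m) \in gz_cells n -> kogan_eqn v r m.

Definition kogan_face v F : Prop := is_face GZC F /\ F v.

(* A table filled with +'s is the set of its cells containing a +. *)
Definition kogan_diagram F : set (nat * nat) :=
  [set c | c \in gz_cells n /\ forall y, F y -> kogan_eqn y c.1 c.2].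

Definition GZC_P (i : nat) : set (gz_space R n) :=
  [set y | gz_coord y 1 i = lam i] `&` GZC.

Definition GZC_Q (i : nat) : set (gz_space R n) :=
  [set y | gz_coord y 1 i = lam i.+1] `&` GZC.

Definition Mgeom v (i : nat) F : set (set (gz_space R n)) :=
  geom_mitosis GZC (GZC_P i) (GZC_Q i) v F.

End GZ.

Section TwoRowMitosis.
Variables (T : Type) (l : nat) (a b : nat -> T).
Implicit Types D : set T.

(* The lists are a 1, ..., a l.+1 and b 1, ..., b l. The condition j <= r, with
   r the length of the initial run of +'s in a, says that a 1, ..., a j all
   contain +. If a 1 is empty, there is no such j and the result is set0. *)
Definition mitosis_J D : set nat :=
  [set j | [/\ (1 <= j <= l.+1)%N,
               (forall k, (1 <= k <= j)%N -> D (a k))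
             & ~ D (b j) \/ j = l.+1]].

Definition mitosis_D D (p : nat) : set T :=
  let moved := [set j | mitosis_J D j /\ (j < p)%N] in
  (D `\` [set a p] `\` (a @` moved)) `|` (b @` moved).

Definition two_row_mitosis D : set (set T) :=
  [set mitosis_D D p | p in mitosis_J D].

End TwoRowMitosis.

Definition MC1 (n : nat) : set (nat * nat) -> set (set (nat * nat)) :=
  two_row_mitosis n.-1
    (fun k => (k.*2.-1, n - k + 1))%N
    (fun k => (k.*2, n - k))%N.

(* For j = 2k-1 or j = 2k one has uphalf j = k. *)
Definition MCi (i : nat) : set (nat * nat) -> set (set (nat * nat)) :=
  two_row_mitosis (i.*2.-1)
    (fun j => (j, i - uphalf j + 1))%N
    (fun j => (j, if odd j then i - uphalf j + 2 else i - uphalf j))%N.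

(* M^C_j for 1 <= j <= n; for j > 1 it is written j = n-i+1 with 1 <= i <= n-1. *)
Definition MC (n j : nat) : set (nat * nat) -> set (set (nat * nat)) :=
  if j == 1%N then MC1 n else MCi (n.+1 - j).

Lemma mem_gz_cells n r m :
  ((r, m) \in gz_cells n) = [&& 0 < r, r < n.*2, 0 < m & m <= n - r./2]%N.
Proof.
apply/allpairsPdep/idP => [[r' [m' [rP mP [-> ->]]]]|H].
  by move: rP mP; rewrite !mem_iota; lia.
by exists r, m; rewrite !mem_iota; split=> //; lia.
Qed.

Lemma kogan_vertex_exists (R : realType) (n : nat) :
  exists v : gz_space R n, kogan_vertex v.
Proof.
pose v : gz_space R n :=
  [ffun c : gz_cell n => lam R n ((ssval c).2 + (ssval c).1./2) : R^o].
have vE r m : (0 < m)%N -> (r < n.*2)%N ->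
    ((r, m) \in gz_cells n) || (r == 0)%N || ~~ odd r && (m + r./2 == n.+1)%N ->
    gz_coord v r m = lam R n (m + r./2).
  move=> m0 rn; rewrite /gz_coord; case: eqP => [->|/eqP r0].
    by rewrite addn0.
  case: insubP => [c _ /= cE|/negbTE-> /= /andP[_ /eqP->]].
    by rewrite ffunE cE.
  by rewrite /lam subnn.
exists v; split=> r m rm; have := rm; rewrite mem_gz_cells => H.
  rewrite !vE ?rm ?mem_gz_cells //; try lia.
  by rewrite /lam !ler_nat; lia.
rewrite /kogan_eqn /eqnA /eqnB; case: ifPn => ro;
  rewrite !vE ?rm ?mem_gz_cells //; try lia; congr (lam _ _ _); lia.
Qed.

(* Main.v *)
(** The coordinates on which the Kogan equations act split into n paths: path c
    starts at the constant lam c and each cell of the table is one edge of a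
    path. Hence v is a simple vertex, the Kogan faces correspond to the sets of
    cells, dim F = n^2 - #|D(F)|, exp(F) is obtained by dropping the cell (1, i),
    and E belongs to the mitosis of F iff D(E) has one cell less than D(F), omits
    (1, i), and together with y^1_i = lam (i+1) forces the equations of D(F) minus
    (1, i). Setting y^1_i = lam (i+1) glues path i to path i+1. Each cell
    b_1, b_2, ... present in D(E) then forces the next equation a_2, a_3, ...,
    and the propagation stops at the first missing b_p; explicit points of the
    polytope show that nothing else is forced. Since no b_j lies in D(F),
    counting cells leaves exactly the diagrams D_p of two-row mitosis. *)

Require Import Defs.
From HB Require Import structures.
From mathcomp Require Import all_boot all_order all_algebra.
From mathcomp Require Import all_classical reals.
From mathcomp Require Import zify lra.

Set Implicit Arguments.
Unset Strict Implicit.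
Unset Printing Implicit Defensive.

Import Order.TTheory GRing.Theory Num.Theory.

Local Open Scope classical_set_scope.
Local Open Scope ring_scope.

(** * Faces through a simple vertex *)

Section SimpleVertex.
Variables (R : realType) (V : vectType R) (C : finType).
Variables (Delta : set V) (v : V) (e : C -> V) (s : C -> {scalar V}).
Hypothesis Delta_v : Delta v.
Hypothesis Delta_e : forall c, Delta (v + e c).
Hypothesis s_e : forall c c', s c (e c') = (c == c')%:R.
Hypothesis s_inj : forall u, (forall c, s c u = 0) -> u = 0.
Hypothesis s_ge0 : forall c y, Delta y -> 0 <= s c (y - v).
Implicit Types D : {set C}.

(** The hypotheses model a simple vertex: [e c] points along the edges at [v] and the slacks [s c]
    are the dual coordinates, so [Delta] lies in the cone at [v] spanned by the [e c]. *)
Definition vface D : set V :=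
  [set y | Delta y /\ forall c, c \in D -> s c (y - v) = 0].

Lemma slack_expand u : u = \sum_c s c u *: e c.
Proof.
apply/eqP; rewrite -subr_eq0; apply/eqP/s_inj => c.
rewrite linearB linear_sum /= (bigD1 c) //= linearZ /= s_e eqxx mulr1.
rewrite big1 ?addr0 ?subrr // => c' c'c.
by rewrite linearZ /= s_e eq_sym (negbTE c'c) mulr0.
Qed.

Lemma vface_v D : vface D v.
Proof. by split=> // c _; rewrite subrr linear0. Qed.

(** The point [v + e c] violates the equation of [c] and no other, so these points recover [D] from
    [vface D]. *)
Lemma vface_e D c : vface D (v + e c) <-> c \notin D.
Proof.
split=> [[_ H]|cD].
  apply/negP => /H; rewrite addrC addKr s_e eqxx => /eqP.
  by rewrite oner_eq0.
split=> // c' c'D; rewrite addrC addKr s_e.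
by case: eqP c'D cD => // -> ->.
Qed.

Lemma vface_sub D D' : vface D `<=` vface D' <-> D' \subset D.
Proof.
split=> [H|/fintype.subsetP H y [yD Hy]].
  apply/fintype.subsetP => c cD'; apply/negPn/negP => /vface_e /H /vface_e.
  by rewrite cD'.
by split=> // c /H /Hy.
Qed.

Lemma vface_inj : injective vface.
Proof.
move=> D D' eD; apply/eqP; rewrite finset.eqEsubset.
by apply/andP; split; apply/vface_sub; rewrite eD.
Qed.

Lemma vfaceI D D' : vface D `&` vface D' = vface (D :|: D').
Proof.
apply/seteqP; split=> y.
  case=> [[yD H] [_ H']]; split=> // c.
  by rewrite inE => /orP[/H|/H'].
by case=> yD H; split; split=> // c cD; apply: H; rewrite inE cD ?orbT.
Qed.

Lemma vface_is_face D : is_face Delta (vface D).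
Proof.
(* All slacks are nonnegative on [Delta], so minus their sum over [D] is maximal at [v] and reaches
   this maximum exactly where each of them vanishes. *)
pose f0 u := - \sum_(c in D) s c u.
have lf : linear_for *%R f0.
  move=> a x y; rewrite /f0 mulrN mulr_sumr -opprD -big_split /=; congr (- _).
  by apply: eq_bigr => c _; rewrite linearP.
pose f : {scalar V} := HB.pack f0 (GRing.isLinear.Build _ _ _ _ f0 lf).
have fE y : f y - f v = - \sum_(c in D) s c (y - v).
  by rewrite -(raddfB f).
exists f, (f v); split=> [x xD|].
  rewrite -subr_le0 fE oppr_le0; apply: sumr_ge0 => c _; exact: s_ge0.
apply/seteqP; split=> y [yD H]; split=> //=.
  by apply/eqP; rewrite -subr_eq0 fE oppr_eq0 big1.
move: H => /= /eqP; rewrite -subr_eq0 fE oppr_eq0 psumr_eq0.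
  by move=> /allP H c cD; have /implyP/(_ cD)/eqP := H c (mem_index_enum _).
by move=> c _; exact: s_ge0.
Qed.

(** A functional maximal at [v] is nonpositive on every edge, so [b - f y] is a sum of nonnegative
    terms; it vanishes iff the slacks of the edges with [f (e c) != 0] do. *)
Lemma face_vface G : is_face Delta G -> G v -> exists D, G = vface D.
Proof.
move=> [f [b [fb ->]]] [_ /= fv].
have fe c : f (e c) <= 0.
  by have := fb _ (Delta_e c); rewrite linearD /= fv; lra.
have fE y : b - f y = \sum_c s c (y - v) * - f (e c).
  rewrite -{1}fv -opprB -(raddfB f) {1}(slack_expand (y - v)) raddf_sum /= -sumrN.
  by apply: eq_bigr => c _; rewrite linearZ /= mulrN.
exists [set c | f (e c) != 0]%SET; apply/seteqP; split=> y [yD H]; split=> //=.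
  move=> c; rewrite inE => fc0.
  have /eqP := fE y; rewrite H subrr eq_sym psumr_eq0; last first.
    by move=> c' _; rewrite mulr_ge0 ?s_ge0 ?oppr_ge0.
  move=> /allP /(_ c (mem_index_enum _)) /=.
  by rewrite mulf_eq0 oppr_eq0 (negbTE fc0) orbF => /eqP.
apply/eqP; rewrite eq_sym -subr_eq0 fE big1 // => c _.
have [->|fc0] := eqVneq (f (e c)) 0; first by rewrite oppr0 mulr0.
by rewrite H ?mul0r ?inE.
Qed.

Lemma free_edges (X : seq C) : uniq X -> free [seq e c | c <- X].
Proof.
elim: X => [_|c X IH /= /andP[cX uX]]; first by rewrite nil_free.
rewrite free_cons IH // andbT; apply/negP => eX.
have eE := coord_span (eX : e c \in <<in_tuple [seq e c | c <- X]>>%VS).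
have: s c (e c) = 0.
  rewrite eE linear_sum /= big1 // => i _; rewrite linearZ /=.
  have iX : (i < size X)%N by rewrite -(size_map e) ltn_ord.
  rewrite (nth_map c) // s_e; case: eqP => [cE|]; last by rewrite mulr0.
  by move: cX; rewrite {1}cE mem_nth.
by rewrite s_e eqxx => /eqP; rewrite oner_eq0.
Qed.

(** Differences of points of the face have zero slack on [D], hence lie in the span of the edges
    outside [D]; [v] and the points [v + e c] with [c] outside [D] attain this bound. *)
Lemma face_dim_vface D : face_dim (vface D) = #|~: D|.
Proof.
set X := [seq e c | c <- enum (~: D)].
have fX : free X by apply: free_edges; exact: enum_uniq.
have szX : size X = #|~: D| by rewrite size_map cardE.
have span u : (forall c, c \in D -> s c u = 0) -> u \in <<X>>%VS.
  move=> H; rewrite (slack_expand u); apply: memv_suml => c _.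
  have [/H ->|cD] := boolP (c \in D); first by rewrite scale0r mem0v.
  by apply: memvZ; apply: memv_span; apply: map_f; rewrite mem_enum inE.
apply/eqP; rewrite eqn_leq; apply/andP; split.
  apply/bigmax_leqP => k /asboolP [x0 [t [[_ H0] Ht <- ft]]].
  rewrite -(size_map (fun x => x - x0)) -szX -(eqP fX) -(eqP ft).
  apply: dimvS; apply/span_subvP => _ /mapP[x xt ->].
  apply: span => c cD.
  have -> : x - x0 = (x - v) - (x0 - v) by rewrite opprB addrA subrK.
  by have [_ Hx] := Ht _ xt; rewrite linearB H0 // Hx // subrr.
have kd : (#|~: D| < (\dim {:V}).+1)%N.
  by rewrite ltnS -szX -(eqP fX) dimvS // subvf.
apply: (@leq_bigmax_cond _ _ (fun k : 'I_(\dim {:V}).+1 => k : nat)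
  (Ordinal kd)).
apply/asboolP.
exists v, [seq v + e c | c <- enum (~: D)]; split.
- exact: vface_v.
- by move=> x /mapP[c]; rewrite mem_enum inE => cD ->; apply/vface_e.
- by rewrite size_map -cardE.
- rewrite -map_comp -(@eq_map _ _ e) // => c /=.
  by rewrite addrC addKr.
Qed.

Variables (c0 : C) (D : {set C}).
Hypothesis c0D : c0 \in D.

(** Intersecting faces unites their sets of equations, so an expansion comes from a set other than
    [D] whose union with [c0] is [D]. *)
Lemma is_exp_vface G :
  is_exp Delta (vface [set c0]%SET) (vface D) G <-> G = vface (D :\ c0).
Proof.
split=> [[Gf GF GP]|->]; last first.
  split; first exact: vface_is_face.
  - by move=> /vface_inj /finset.setP /(_ c0); rewrite !inE eqxx c0D.
  - by rewrite vfaceI finset.setUC finset.setD1K.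
have [D' GE] : exists D', G = vface D'.
  apply: face_vface => //; have := vface_v D; rewrite -GP; by case.
move: GF GP; rewrite GE vfaceI => GF /vface_inj DE.
have c0D' : c0 \notin D'.
  apply/negP => H; apply: GF; rewrite -DE; congr vface.
  by apply/esym/finset.setUidPl; rewrite finset.sub1set.
by rewrite -DE finset.setUC finset.setU1K.
Qed.

Lemma admissible_vface : admissible Delta (vface [set c0]%SET) (vface D).
Proof.
split; first exact: vface_is_face.
  by apply/vface_sub; rewrite finset.sub1set.
by exists (vface (D :\ c0)); split=> [|G]; rewrite is_exp_vface.
Qed.

(** The dimension counts the cells outside the set, [E] leaves P iff [c0] is dropped, and [E] is
    never inside [Q] because it contains [v]. *)
Lemma geom_mitosis_vface Q D' : ~ Q v ->
  geom_mitosis Delta (vface [set c0]%SET) Q v (vface D) (vface D') <->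
  [/\ #|D| = #|D'|.+1, c0 \notin D' & vface D' `&` Q `<=` vface (D :\ c0)].
Proof.
move=> Qv.
have cE : #|~: D'| = #|~: D|.+1 <-> #|D| = #|D'|.+1.
  by have := cardsC D; have := cardsC D'; lia.
split=> [[G /is_exp_vface ->]|[DD' c0D' H]].
  rewrite !face_dim_vface => -[_ /cE DD' EP _ H]; split=> //.
    by apply/negP => c0D'; apply: EP; apply/vface_sub; rewrite finset.sub1set.
  by move=> y /H [].
exists (vface (D :\ c0)); first exact/is_exp_vface.
split.
- by split; [exact: vface_is_face | exact: vface_v].
- by rewrite !face_dim_vface; apply/cE.
- by move=> /vface_sub; rewrite finset.sub1set (negbTE c0D').
- by move=> /(_ _ (vface_v D')).
- by move=> y yQ; split; [exact: H | case: yQ].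
Qed.

End SimpleVertex.

(** * Two-row mitosis *)

Section MitosisAsClosure.
Variables (C : finType) (T : Type) (h : C -> T) (l : nat).
Variables (a b : nat -> C) (a0 b0 : nat -> T).
Hypothesis h_inj : injective h.
Hypothesis h_a : forall j, (1 <= j <= l.+1)%N -> h (a j) = a0 j.
Hypothesis h_b : forall j, (1 <= j <= l)%N -> h (b j) = b0 j.
Hypothesis a_inj : {in [pred j | 1 <= j <= l.+1]%N &, injective a}.
Hypothesis b_inj : {in [pred j | 1 <= j <= l]%N &, injective b}.
Hypothesis ab : forall j k, (1 <= j <= l.+1)%N -> (1 <= k <= l)%N -> a j != b k.
Variables (D : {set C}).
Hypothesis a1D : a 1%N \in D.
Hypothesis bD : forall j, (1 <= j <= l)%N -> b j \notin D.

Let As m k : {set C} := [set c in [seq a j | j <- iota m k]]%SET.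
Let Bs k : {set C} := [set c in [seq b j | j <- iota 1 k]]%SET.

Let AsP m k c : reflect (exists2 j, (m <= j < m + k)%N & c = a j) (c \in As m k).
Proof.
rewrite inE; apply: (iffP mapP) => -[j]; rewrite ?mem_iota => jP ->; exists j => //.
by rewrite mem_iota.
Qed.

Let BsP k c : reflect (exists2 j, (1 <= j <= k)%N & c = b j) (c \in Bs k).
Proof.
rewrite inE; apply: (iffP mapP) => -[j]; rewrite ?mem_iota => jP ->; exists j => //.
by rewrite mem_iota.
Qed.

Let card_As m k : (0 < m)%N -> (m + k <= l.+2)%N -> #|As m k| = k.
Proof.
move=> m0 mk; rewrite cardsE (card_uniqP _) ?size_map ?size_iota //.
rewrite map_inj_in_uniq ?iota_uniq // => i j; rewrite !mem_iota => iP jP.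
by apply: a_inj; rewrite inE; lia.
Qed.

Let card_Bs k : (k <= l)%N -> #|Bs k| = k.
Proof.
move=> mk; rewrite cardsE (card_uniqP _) ?size_map ?size_iota //.
rewrite map_inj_in_uniq ?iota_uniq // => i j; rewrite !mem_iota => iP jP.
by apply: b_inj; rewrite inE; lia.
Qed.

Let card_UBs k (X : {set C}) : (k <= l)%N -> X \subset D ->
  #|X :|: Bs k| = (#|X| + #|Bs k|)%N.
Proof.
move=> kl /fintype.subsetP XD; apply/eqP; rewrite (leq_card_setU _ _).2.
rewrite disjoint_sym; apply/pred0P => c /=; apply/negP => /andP[/BsP[j jp ->]].
by move=> /XD; apply/negP/bD; lia.
Qed.

Let Dp p : {set C} := (D :\: As 1 p) :|: Bs p.-1.

(** No [b j] lies in [D], so the clause on [b j] always holds and only the initial run of filled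
    [a k] matters; hence every index below [p] moves. *)
Lemma mitosis_J_image j : mitosis_J l a0 b0 (h @` [set` D]) j <->
  (1 <= j <= l.+1)%N /\ forall k, (1 <= k <= j)%N -> a k \in D.
Proof.
have hD c : (h @` [set` D]) (h c) -> c \in D by case=> c' c'D /h_inj <-.
split=> [[jl H _]|[jl H]].
  by split=> // k kj; apply: hD; rewrite h_a; [exact: H | lia].
split=> // [k kj|].
- by rewrite -h_a; [exists (a k) => //; exact: H | lia].
- have [->|jl1] := eqVneq j l.+1; [by right | left].
  by rewrite -h_b; [move/hD; apply/negP/bD; lia | lia].
Qed.

Lemma mitosis_D_image p : mitosis_J l a0 b0 (h @` [set` D]) p ->
  mitosis_D l a0 b0 (h @` [set` D]) p = h @` [set` Dp p].
Proof.
move=> /mitosis_J_image [pl Hp].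
have JE j : mitosis_J l a0 b0 (h @` [set` D]) j /\ (j < p)%N <-> (1 <= j < p)%N.
  split=> [[/mitosis_J_image[]]|jp]; first by lia.
  split; last by lia.
  by apply/mitosis_J_image; split=> [|k kj]; [|apply: Hp]; lia.
apply/seteqP; split=> t.
  case=> [[[[c cD <-] cap] caj]|[j /JE jp <-]].
    exists c => //=; rewrite !inE cD andbT; apply/orP; left.
    apply/negP => /mapP[j]; rewrite mem_iota => jp cE.
    have [jE|jnp] := eqVneq j p.
      by apply: cap; rewrite /= cE h_a jE //; lia.
    by apply: caj; exists j; [apply/JE; lia | rewrite cE h_a //; lia].
  exists (b j); last by rewrite h_b //; lia.
  by rewrite /= inE; apply/orP; right; apply/BsP; exists j => //; lia.
case=> c /=; rewrite inE => /orP[|/BsP[j jp ->] <-]; last first.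
  right; exists j; last by rewrite h_b //; lia.
  by apply/JE; lia.
rewrite finset.in_setD => /andP[/AsP cA cD <-]; left; split; first split.
- by exists c.
- rewrite /= -h_a; last by lia.
  by move=> /h_inj cE; apply: cA; exists p => //; lia.
- case=> j /JE jp; rewrite -h_a; last by lia.
  by move=> /h_inj cE; apply: cA; exists j => //; lia.
Qed.

(* [impl c] stands for: the equation of the cell [c] holds on the part of the
   face with diagram [D'] lying in Q. *)
Variables (D' : {set C}) (impl : C -> Prop).
Hypothesis impl_D' : forall c, c \in D' -> impl c.
Hypothesis impl_a : forall p, (1 <= p <= l.+1)%N ->
  (forall j, (1 <= j < p)%N -> b j \in D') ->
  forall j, (2 <= j <= p)%N -> impl (a j).
Hypothesis impl_only : a 1%N \notin D' -> forall p, (1 <= p <= l.+1)%N ->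
  (forall j, (1 <= j < p)%N -> b j \in D') ->
  p = l.+1 \/ b p \notin D' ->
  forall c, impl c -> c \in D' \/ exists2 j, (2 <= j <= p)%N & c = a j.

(* If [p] is the first index with [b p] outside [D'], then [D'] contains
   [D] minus [a 1, ..., a p] together with [b 1, ..., b (p-1)]; counting
   cells leaves no room for anything else. *)
Lemma two_row_mitosis_closure :
  [/\ #|D| = #|D'|.+1, a 1%N \notin D' & forall c, c \in D :\ a 1%N -> impl c]
  <-> two_row_mitosis l a0 b0 (h @` [set` D]) (h @` [set` D']).
Proof.
split=> [[DD' a1D' Himpl]|[p Jp]].
  have ex : exists p, (0 < p)%N && ((p == l.+1) || (b p \notin D')).
    by exists l.+1; rewrite eqxx.
  case: (ex_minnP ex) => p /andP[p0 pE] pmin.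
  have pl : (p <= l.+1)%N by apply: pmin; rewrite eqxx.
  have bD' j : (1 <= j < p)%N -> b j \in D'.
    move=> jp; apply/negPn/negP => bj.
    by have := pmin j; rewrite bj orbT andbT; lia.
  have only c : c \in D :\ a 1%N -> c \in D' :|: As 2 p.-1.
    move=> /Himpl /(impl_only a1D' _ bD') H; rewrite inE.
    case: H => [|| ->|[j jp cE]] //; first by lia.
      by case/orP: pE => [/eqP|]; [left|right].
    by apply/orP; right; apply/AsP; exists j => //; lia.
  (* [D :\ a 1] has as many cells as [D']. Trading its at most [p - 1] cells among [a 2, ..., a p]
     for exactly [p - 1] cells [b j] gives a subset [X] of [D'] that is no smaller. So [X = D'], and
     all of [a 2, ..., a p] lie in [D]. *)
  have c1 := cardsD1 (a 1%N) D; rewrite a1D in c1.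
  have c2 := cardsID (As 2 p.-1) (D :\ a 1%N).
  have c3 : #|As 2 p.-1| = p.-1 by apply: card_As; lia.
  have c4 : #|Bs p.-1| = p.-1 by apply: card_Bs; lia.
  have sI := subset_leq_card (finset.subsetIr (D :\ a 1%N) (As 2 p.-1)).
  set X := (D :\ a 1%N) :\: As 2 p.-1 :|: Bs p.-1.
  have cX : #|X| = (#|(D :\ a 1%N) :\: As 2 p.-1| + #|Bs p.-1|)%N.
    apply: card_UBs; first by lia.
    exact: fintype.subset_trans (finset.subsetDl _ _) (finset.subD1set _ _).
  have XD' : X \subset D'.
    apply/fintype.subsetP => c; rewrite inE => /orP[|/BsP[j jp ->]].
      rewrite finset.in_setD => /andP[cA /only].
      by rewrite inE (negbTE cA) orbF.
    by apply: bD'; lia.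
  have XE : X = D'.
    by apply/eqP; rewrite finset.eqEcard XD' /=; lia.
  have sA : As 2 p.-1 \subset D :\ a 1%N.
    have cXD := congr1 (fun A : {set C} => #|A|) XE; rewrite /= in cXD.
    apply/finset.setIidPr; apply/eqP.
    by rewrite finset.eqEcard finset.subsetIr /=; lia.
  have aD j : (1 <= j <= p)%N -> a j \in D.
    have [-> //|j1 jp] := eqVneq j 1%N.
    have /(fintype.subsetP sA) : a j \in As 2 p.-1.
      by apply/AsP; exists j => //; lia.
    by rewrite inE => /andP[].
  have Jp : mitosis_J l a0 b0 (h @` [set` D]) p.
    by apply/mitosis_J_image; split=> //; lia.
  exists p => //; rewrite mitosis_D_image //.
  suff -> : Dp p = D' by [].
  rewrite -XE /Dp /X; congr finset.setU; apply/finset.setP => c.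
  rewrite !finset.in_setD.
  rewrite finset.in_set1 andbA; congr (_ && _).
  rewrite /As !inE.
  case: p p0 {pE pmin pl bD' only c2 c3 c4 sI X cX XD' XE sA aD Jp} => //= p _.
  by rewrite inE negb_or andbC.
have := Jp; rewrite mitosis_D_image // => /mitosis_J_image[pl aD] E.
have DpE : Dp p = D'.
  apply/finset.setP => c; apply/idP/idP => cD.
    have : (h @` [set` D']) (h c) by rewrite -E; exists c.
    by case=> c' c'D' /h_inj <-.
  have : (h @` [set` Dp p]) (h c) by rewrite E; exists c.
  by case=> c' c'D' /h_inj <-.
have bD' j : (1 <= j < p)%N -> b j \in D'.
  move=> jp; rewrite -DpE inE; apply/orP; right; apply/BsP.
  by exists j => //; lia.
split.
- have sA : As 1 p \subset D.
    by apply/fintype.subsetP => c /AsP[j jp ->]; apply: aD; lia.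
  have := cardsID (As 1 p) D; rewrite (finset.setIidPr sA).
  rewrite card_As; [|lia|lia]; rewrite -DpE /Dp.
  have -> : #|(D :\: As 1 p) :|: Bs p.-1| = (#|D :\: As 1 p| + #|Bs p.-1|)%N.
    by apply: card_UBs; [lia|exact: finset.subsetDl].
  by rewrite card_Bs; lia.
- rewrite -DpE inE negb_or finset.in_setD negb_and negbK; apply/andP; split.
    by apply/orP; left; apply/AsP; exists 1%N => //; lia.
  apply/BsP => -[j jp]; apply/eqP; apply: ab; lia.
- move=> c; rewrite finset.in_setD1 => /andP[c1 cD].
  have [/AsP[j jp cE]|cA] := boolP (c \in As 1 p).
    rewrite cE; apply: (impl_a pl bD').
    by have [j1|] := eqVneq j 1%N; [rewrite cE j1 eqxx in c1 | lia].
  by apply: impl_D'; rewrite -DpE inE finset.in_setD cA cD.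
Qed.
End MitosisAsClosure.

(** * Paths and explicit points of the polytope *)

Section Levels.
Variables (R : realType) (n : nat).
Implicit Types (y u v : gz_space R n).

(* The Kogan equations link the coordinates along the n paths
   (0, c) - (1, c) - (2, c-1) - (3, c-1) - ... - (2c-1, 1);
   [lev y c r] is the coordinate in row r of the c-th path. *)
Definition lev y (c r : nat) : R := gz_coord y r (c - r./2).

Definition edge (c r : nat) : bool := [&& 0 < c, c <= n, 0 < r & r < c.*2]%N.

Lemma edge_cell c r : edge c r -> (r, c - r./2)%N \in gz_cells n.
Proof. by rewrite /edge mem_gz_cells; lia. Qed.

Lemma cell_edge r m : (r, m) \in gz_cells n ->
  edge (m + r./2) r /\ m = ((m + r./2) - r./2)%N.
Proof. by rewrite /edge mem_gz_cells; lia. Qed.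

Lemma lev0 y c : lev y c 0 = lam R n c.
Proof. by rewrite /lev /gz_coord subn0. Qed.

(** Along a path the column drops by one exactly on entering an even row, which is where the Kogan
    equation is of type B. *)
Lemma kogan_eqn_lev y c r : edge c r ->
  kogan_eqn y r (c - r./2) <-> lev y c r = lev y c r.-1.
Proof.
rewrite /edge /kogan_eqn /eqnA /eqnB /lev => cr; case: ifPn => ro.
  by have -> : (r.-1)./2 = r./2 by lia.
by have -> : (c - r.-1./2 = (c - r./2).+1)%N by lia.
Qed.

(** Of the two inequalities at a cell, one runs along its path and the other compares it with a
    neighbouring path. *)
Lemma GZC_lev y : GZC y <-> forall c r, edge c r ->
  if odd r then lev y c r <= lev y c r.-1 /\ lev y c.+1 r.-1 <= lev y c r
  else lev y c r.-1 <= lev y c r /\ lev y c r <= lev y c.-1 r.-1.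
Proof.
have E c r : edge c r ->
    (if odd r then lev y c r <= lev y c r.-1 /\ lev y c.+1 r.-1 <= lev y c r
     else lev y c r.-1 <= lev y c r /\ lev y c r <= lev y c.-1 r.-1) <->
    gz_coord y r.-1 (c - r./2) >= gz_coord y r (c - r./2) /\
    gz_coord y r (c - r./2) >= gz_coord y r.-1 (c - r./2).+1.
  rewrite /edge /lev => cr; case: ifPn => ro.
    have -> : (r.-1)./2 = r./2 by lia.
    by have -> : (c.+1 - r./2 = (c - r./2).+1)%N by lia.
  have -> : (c - r.-1./2 = (c - r./2).+1)%N by lia.
  have -> : (c.-1 - r.-1./2 = c - r./2)%N by lia.
  by split=> -[].
split=> H.
  by move=> c r cr; apply/E => //; apply/H/edge_cell.
move=> r m /cell_edge [cr mE].
by rewrite mE; apply/E => //; exact: H.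
Qed.

(** Linear part of the affine function [gz_coord]: row 0 has no cells, so the constants [lam] become
    0. *)
Definition lincoord u (r m : nat) : R :=
  oapp (u : {ffun gz_cell n -> R^o}) 0 (insub (r, m)).

Lemma lincoord_linear r m : linear_for *%R (fun u => lincoord u r m).
Proof.
move=> a x y; rewrite /lincoord; case: insub => [c|] /=.
  by rewrite !ffunE.
by rewrite mulr0 addr0.
Qed.

Lemma lincoordB y v r m : lincoord (y - v) r m = gz_coord y r m - gz_coord v r m.
Proof.
rewrite /gz_coord /lincoord; case: eqP => [->|_].
  rewrite subrr insubF // mem_gz_cells; lia.
by case: insub => [c|] /=; rewrite ?ffunE ?subrr.
Qed.

(* The vertex is perturbed along each path by multiples of 1 / scale, too small
   to interfere with the unit gaps between the [lam c]. *)
Definition scale : nat := (16 * n)%N.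

Definition kslack (c : nat * nat) u : R := scale%:R *
  (if odd c.1 then lincoord u c.1.-1 c.2 - lincoord u c.1 c.2
   else lincoord u c.1 c.2 - lincoord u c.1.-1 c.2.+1).

Lemma kslack_linear c : linear_for *%R (kslack c).
Proof.
move=> a x y; rewrite /kslack.
by case: ifP => _; rewrite !lincoord_linear /=; lra.
Qed.

HB.instance Definition _ c :=
  GRing.isLinear.Build _ _ _ _ (kslack c) (@kslack_linear c).

(** Induction on rows: zero slack equates each coordinate with one in the row above, and row 0 is
    zero. *)
Lemma kslack_inj u : (0 < n)%N ->
  (forall c : gz_cell n, kslack (val c) u = 0) -> u = 0.
Proof.
move=> n0 H; have s0 : scale%:R != 0 :> R by rewrite pnatr_eq0 /scale; lia.
have L r m : lincoord u r m = 0.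
  elim: r m => [|r IH] m; rewrite /lincoord.
    by rewrite insubF // mem_gz_cells; lia.
  case: insubP => [c _ cE|//].
  have /eqP := H c; rewrite /kslack cE mulf_eq0 (negbTE s0) /=.
  rewrite [in lincoord u r.+1 m]/lincoord -cE valK /= !IH.
  by case: ifP => _; rewrite ?add0r ?subr0 ?oppr_eq0 => /eqP.
apply/ffunP => c; have := L (val c).1 (val c).2.
by rewrite /lincoord -surjective_pairing valK /= ffunE.
Qed.

Definition kogan_slack y (c r : nat) : R :=
  if odd r then lev y c r.-1 - lev y c r else lev y c r - lev y c r.-1.

Lemma kslackB y v c r : edge c r ->
  kslack (r, c - r./2)%N (y - v) =
  scale%:R * (kogan_slack y c r - kogan_slack v c r).
Proof.
rewrite /kslack /kogan_slack /edge /lev => cr /=.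
rewrite !lincoordB; case: ifPn => ro.
  have -> : (r.-1)./2 = r./2 by lia.
  by congr (_ * _); lra.
have -> : (c - r.-1./2 = (c - r./2).+1)%N by lia.
by congr (_ * _); lra.
Qed.

(** [X] is indexed by path and row in units of 1 / [scale], which turns membership in the polytope
    into integer arithmetic. *)
Definition mkpt (X : nat -> nat -> int) : gz_space R n :=
  [ffun c : gz_cell n =>
    (X ((val c).2 + (val c).1./2)%N (val c).1)%:~R / scale%:R : R^o].

Definition height (c : nat) : int := (scale * (n.+1 - c))%N.

(** Path [n.+1] has no cells: its row 0 is [lam n.+1 = 0], and its other rows read the default 0 of
    [gz_coord]. *)
Lemma lev_mkpt X c r : (0 < n)%N ->
  (forall c, X c 0%N = height c) -> (c <= n.+1)%N -> (r < c.*2)%N ->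
  lev (mkpt X) c r = (if (c <= n)%N then X c r else 0)%:~R / scale%:R.
Proof.
move=> n0 X0 cn rc; have s0 : scale%:R != 0 :> R by rewrite pnatr_eq0 /scale; lia.
rewrite /lev /gz_coord; case: eqP => [->|/eqP r0].
  rewrite X0 subn0 /lam /height; case: ifPn => cn'.
    by rewrite -pmulrn natrM mulrAC divff // mul1r.
  have -> : (n.+1 - c = 0)%N by lia.
  by rewrite mul0r.
case: insubP => [d _ dE|dF] /=.
  have : (r, c - r./2)%N \in gz_cells n by rewrite -dE; exact: valP.
  rewrite mem_gz_cells ffunE dE /= => dP.
  have -> : (c - r./2 + r./2 = c)%N by lia.
  by have -> : (c <= n)%N by lia.
case: ifPn => cn'; last by rewrite mul0r.
by move: dF; rewrite mem_gz_cells; lia.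
Qed.

Lemma mkpt_lev_le X c r c' r' : (0 < n)%N -> (forall c, X c 0%N = height c) ->
  (c <= n.+1)%N -> (r < c.*2)%N -> (c' <= n.+1)%N -> (r' < c'.*2)%N ->
  (lev (mkpt X) c r <= lev (mkpt X) c' r') =
  ((if (c <= n)%N then X c r else 0) <= (if (c' <= n)%N then X c' r' else 0)).
Proof.
move=> n0 X0 cn rc cn' rc'; rewrite !lev_mkpt //.
by rewrite ler_pM2r ?ler_int // invr_gt0 ltr0n /scale; lia.
Qed.

(** Each step goes the way the inequality along the path allows, down at odd rows and up at even
    ones; rows in [S] are skipped. *)
Fixpoint zigzag (S : pred nat) (r : nat) : int :=
  if r is r'.+1 then
    zigzag S r' + (if S r then 0 else if odd r then -1 else 1)
  else 0.

Lemma zigzag_step S r : (0 < r)%N ->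
  zigzag S r = zigzag S r.-1 + (if S r then 0 else if odd r then -1 else 1).
Proof. by case: r. Qed.

(** For rows up to 2n the perturbation is at most 2n, an eighth of [scale], so two paths half a gap
    (8n) apart cannot cross. *)
Lemma zigzag_bound S r : - r%:Z <= zigzag S r <= r%:Z.
Proof.
elim: r => //= r IH; case: (S r.+1); first by lia.
by case: (odd r) => /=; lia.
Qed.

Lemma zigzag0 (S : pred nat) s r :
  (forall j, (0 < j <= s)%N -> S j) -> (r <= s)%N -> zigzag S r = 0.
Proof.
by move=> H; elim: r => //= r IH rs; rewrite IH ?H //; lia.
Qed.

(* With s = 0 the point with free cells L has slack 1 / scale exactly on L.
   For s > 0 it lies in the facet y^1_i = lam (i+1): path i drops to the level
   of path i+1 from row 1 on, returning at row s if s is even; if s is odd it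
   is path i+1 which drops by half a unit at row s. *)
Definition base (i s c r : nat) : int :=
  if c == i then
    if (r == 0%N) || (~~ odd s && (s <= r)%N) then height i else height i.+1
  else if [&& c == i.+1, odd s & s <= r]%N then height c - (8 * n)%N%:Z
  else height c.

(** Up to row [s] the paths [i] and [i.+1] may touch, so their perturbation is switched off there,
    whatever [L] is. *)
Definition frozen (i s : nat) (L : seq (nat * nat)) (c : nat) : pred nat :=
  [pred r | ((c == i) || (c == i.+1)) && (r <= s)%N
            || ((r, c - r./2)%N \notin L)].

Definition witness i s L (c r : nat) : int :=
  base i s c r + zigzag (frozen i s L c) r.

Section Witness.
Variables (i s : nat) (L : seq (nat * nat)).
Hypothesis n0 : (0 < n)%N.
Hypothesis i_n : (i <= n)%N.
Hypothesis s_i : (s <= i.*2)%N.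
Hypothesis s_odd : odd s -> (i < n)%N.
Hypothesis s_gt0 : (0 < i)%N -> (0 < s)%N.

Lemma witness0 c : witness i s L c 0 = height c.
Proof.
rewrite /witness /base addr0 eqxx /=; case: eqP => [->//|_].
by case: ifP => // /and3P[_ so]; case: s so.
Qed.

Lemma height_step c : (c <= n)%N -> height c = height c.+1 + scale.
Proof. by move=> cn; rewrite /height -PoszD -mulnSr; congr (Posz (_ * _)); lia. Qed.

Lemma zigzag_frozen0 c r : (c == i) || (c == i.+1) -> (r <= s)%N ->
  zigzag (frozen i s L c) r = 0.
Proof.
by move=> ci; apply: zigzag0 => j /andP[_ js]; rewrite /frozen /= ci js.
Qed.

Lemma baseE c r : base i s c r = height c
  - (if [&& c == i, (0 < r)%N & odd s || (r < s)%N] then scale%:Z else 0)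
  - (if [&& c == i.+1, odd s & s <= r]%N then (8 * n)%N%:Z else 0).
Proof.
have hi := height_step i_n; rewrite /base.
case: (c =P i) => [->|_] /=; last by case: ifP => _; lia.
by repeat case: ifP => ?; lia.
Qed.

(** The jumps of [base] respect the parity: path [i] drops at row 1 and rises at an even [s], path
    [i.+1] drops at an odd [s]. *)
Lemma witness_path c r : edge c r ->
  if odd r then witness i s L c r <= witness i s L c r.-1
  else witness i s L c r.-1 <= witness i s L c r.
Proof.
rewrite /edge => /and4P[c0 cn r0 rc].
have zs := zigzag_step (frozen i s L c) r0.
rewrite /witness !baseE /scale {}zs; case: ifPn => ro; case: (frozen i s L c r).
all: by repeat case: ifP => ?; lia.
Qed.

(** Neighbouring paths are at least half a gap apart, except paths [i] and [i.+1] before they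
    separate at row [s]; there both are unperturbed at the same height. *)
Lemma witness_cross c r r' : odd r -> (c <= n)%N -> (r < c.*2)%N ->
  (r' <= r.+1)%N -> (r <= r'.+1)%N ->
  (if (c < n)%N then witness i s L c.+1 r' else 0) <= witness i s L c r.
Proof.
move=> ro cn rc r'r rr'.
have hn : ~~ (c < n)%N -> height c.+1 = 0.
  move=> cn'; rewrite /height; have -> : (n.+1 - c.+1 = 0)%N by lia.
  by rewrite muln0.
have hc := height_step cn; rewrite /scale in hc.
have := @zigzag_frozen0 c r; have := @zigzag_frozen0 c.+1 r'.
have := zigzag_bound (frozen i s L c) r.
have := zigzag_bound (frozen i s L c.+1) r'.
rewrite /witness !baseE /scale.
move: (zigzag _ r) (zigzag _ r') => Z Z'.
move: (height c) (height c.+1) hn hc => H H1 hn hc b' b.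
have [ci|ci] := eqVneq c i.
  have -> : (c.+1 == i) = false by lia.
  have -> : (c.+1 == i.+1) = true by lia.
  have -> : (c == i.+1) = false by lia.
  move=> /= /(_ isT) z' /(_ isT) z.
  by have [so|so] := boolP (odd s) => /=; repeat case: ifP => ?; lia.
move=> _ _; rewrite eqSS (negbTE ci) /=.
by repeat case: ifP => ?; lia.
Qed.

Lemma witness_GZC : GZC (mkpt (witness i s L)).
Proof.
apply/GZC_lev => c r cr; have := cr; rewrite /edge => /and4P[c0 cn r0 rc].
have := witness_path cr.
have [ro|ro] := boolP (odd r); rewrite !(mkpt_lev_le n0 witness0) ?cn; try lia.
  by move=> ->; split=> //; apply: witness_cross => //; lia.
move=> ->; split=> //.
have -> : (c.-1 <= n)%N by lia.
have := @witness_cross c.-1 r.-1 r; rewrite (prednK c0) cn.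
by apply; lia.
Qed.

(** A free cell can satisfy its equation only where paths [i] and [i.+1] are frozen. The first
    alternative collects the cells [a j], without row 1 where path [i] drops; the second collects
    the [b j] before the jump at row [s]. *)
Lemma witness_free c r : edge c r -> (r, c - r./2)%N \in L ->
  witness i s L c r = witness i s L c r.-1 ->
  (2 <= r <= s)%N && (if odd r then c == i else c == i.+1) ||
  (r < s)%N && (if odd r then c == i.+1 else c == i).
Proof.
rewrite /edge => /and4P[c0 cn r0 rc] rL.
have zs := zigzag_step (frozen i s L c) r0.
have zb := zigzag_bound (frozen i s L c) r.-1.
rewrite /witness !baseE /scale {}zs /frozen inE rL orbF.
have [ci|ci] := eqVneq c i.
  have -> : (c == i.+1) = false by lia.
  by have [so|so] := boolP (odd s) => /=; repeat case: ifP => ?; lia.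
have [ci'|ci'] := eqVneq c i.+1.
  by have [so|so] := boolP (odd s) => /=; repeat case: ifP => ?; lia.
by move=> /=; repeat case: ifP => ?; lia.
Qed.

Lemma witness_frozen c r : edge c r -> (r, c - r./2)%N \notin L ->
  ~~ ((c == i) && (r == 1%N)) ->
  ~~ ((r == s) && (if odd s then c == i.+1 else c == i)) ->
  witness i s L c r = witness i s L c r.-1.
Proof.
rewrite /edge => /and4P[c0 cn r0 rc] rL.
have zs := zigzag_step (frozen i s L c) r0.
rewrite /witness !baseE /scale {}zs /frozen inE rL orbT addr0.
have [ci|ci] := eqVneq c i.
  have -> : (c == i.+1) = false by lia.
  by have [so|so] := boolP (odd s) => /=; repeat case: ifP => ?; lia.
by have [so|so] := boolP (odd s) => /=; repeat case: ifP => ?; lia.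
Qed.

Lemma kogan_eqn_witness c r : edge c r ->
  kogan_eqn (mkpt (witness i s L)) r (c - r./2) <->
  witness i s L c r = witness i s L c r.-1.
Proof.
move=> cr; rewrite kogan_eqn_lev //; move: cr; rewrite /edge => /and4P[c0 cn r0 rc].
have s0 : scale%:R != 0 :> R by rewrite pnatr_eq0 /scale; lia.
rewrite !(lev_mkpt n0 witness0) ?cn; try lia.
split=> [/(mulIf (invr_neq0 s0))/eqP|->//].
by rewrite eqr_int => /eqP.
Qed.

Lemma witness_Q : (0 < i)%N -> gz_coord (mkpt (witness i s L)) 1 i = lam R n i.+1.
Proof.
move=> i0; have s1 := s_gt0 i0.
have -> : gz_coord (mkpt (witness i s L)) 1 i = lev (mkpt (witness i s L)) i 1.
  by rewrite /lev subn0.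
have s0 : scale%:R != 0 :> R by rewrite pnatr_eq0 /scale; lia.
rewrite (lev_mkpt n0 witness0) ?i_n; try lia.
rewrite /witness zigzag_frozen0 ?eqxx // addr0 /base eqxx /=.
have -> : ~~ odd s && (s <= 1)%N = false by lia.
by rewrite /height -pmulrn natrM mulrAC divff // mul1r.
Qed.

End Witness.

Lemma kogan_slack_dual (d : nat * nat) c r : (0 < n)%N -> edge c r ->
  scale%:R * kogan_slack (mkpt (witness 0 0 [:: d])) c r =
  ((r, c - r./2)%N == d)%:R.
Proof.
move=> n0 cr; have := cr; rewrite /edge => /and4P[c0 cn r0 rc].
have s0 : scale%:R != 0 :> R by rewrite pnatr_eq0 /scale; lia.
have w0 := @witness0 0 0 [:: d].
rewrite /kogan_slack !(lev_mkpt n0 w0) ?cn; try lia.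
rewrite -!mulrBl -!rmorphB /=.
have -> : witness 0 0 [:: d] c r =
  witness 0 0 [:: d] c r.-1 +
  (if (r, c - r./2)%N != d then 0 else if odd r then -1 else 1).
  rewrite /witness zigzag_step // /frozen inE /base.
  have -> : (r <= 0)%N = false by lia.
  by rewrite andbF /= mem_seq1 !andbF addrA; case: eqP => //; lia.
case: eqP => _ /=; case: (odd r); rewrite ?addr0 ?subrr ?mul0r ?mulr0 //.
  by rewrite opprD addrA subrr add0r opprK mul1r divff.
by rewrite addrC addKr mul1r divff.
Qed.
End Levels.

(** * Kogan faces *)

Section KoganFaces.
Variables (R : realType) (n : nat) (v : gz_space R n).
Hypothesis n0 : (0 < n)%N.
Hypothesis vK : kogan_vertex v.
Implicit Types (y : gz_space R n) (D : {set gz_cell n}).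

Definition kogan_edge (c : gz_cell n) : gz_space R n :=
  mkpt R n (witness n 0 0 [:: val c]) - v.

Definition kogan_functional (c : gz_cell n) : {scalar gz_space R n} :=
  @kslack R n (val c).

Definition kface D : set (gz_space R n) := vface (@GZC R n) v kogan_functional D.

Lemma gz_cellE (d : gz_cell n) : exists2 c : nat,
  edge n c (val d).1 & val d = ((val d).1, c - (val d).1./2)%N.
Proof.
case: d => -[r m] /= rm; have [cr mE] := cell_edge rm.
by exists (m + r./2)%N => //; rewrite -mE.
Qed.

Lemma kogan_slack_eq0 y c r : edge n c r ->
  kogan_slack y c r = 0 <-> kogan_eqn y r (c - r./2).
Proof.
move=> cr; rewrite kogan_eqn_lev // /kogan_slack.
by case: ifP => _; split=> [/eqP|->]; rewrite ?subrr // subr_eq0 => /eqP.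
Qed.

Lemma kogan_functionalB y c r (d : gz_cell n) : edge n c r ->
  val d = (r, c - r./2)%N ->
  kogan_functional d (y - v) = (scale n)%:R * kogan_slack y c r.
Proof.
move=> cr dE; rewrite /kogan_functional /= dE kslackB //.
have -> : kogan_slack v c r = 0.
  by apply/kogan_slack_eq0 => //; apply: vK.2; exact: edge_cell.
by rewrite subr0.
Qed.

Let scale_neq0 : (scale n)%:R != 0 :> R.
Proof. by rewrite pnatr_eq0 /scale; lia. Qed.

Lemma kogan_functional_eq0 y (d : gz_cell n) :
  kogan_functional d (y - v) = 0 <-> kogan_eqn y (val d).1 (val d).2.
Proof.
have [c cr dE] := gz_cellE d; rewrite (kogan_functionalB _ cr dE).
rewrite [in X in _ <-> X]dE -kogan_slack_eq0 //=.
split=> [/eqP|->]; last by rewrite mulr0.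
by rewrite mulf_eq0 (negbTE scale_neq0) => /eqP.
Qed.

Let vGZC : GZC v := vK.1.

Let edgeGZC c : GZC (v + kogan_edge c).
Proof. by rewrite addrC subrK; apply: witness_GZC. Qed.

Let dual c c' : kogan_functional c (kogan_edge c') = (c == c')%:R.
Proof.
have [k kr dE] := gz_cellE c; rewrite (kogan_functionalB _ kr dE).
by rewrite kogan_slack_dual // -dE (inj_eq val_inj).
Qed.

Let sep u : (forall c, kogan_functional c u = 0) -> u = 0.
Proof. exact: kslack_inj. Qed.

Let pos c y : GZC y -> 0 <= kogan_functional c (y - v).
Proof.
have [k kr dE] := gz_cellE c; rewrite (kogan_functionalB _ kr dE).
move=> /GZC_lev /(_ _ _ kr) H; rewrite mulr_ge0 // /kogan_slack.
by case: ifP H => _ [H _]; rewrite subr_ge0.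
Qed.

Lemma kfaceP D y : kface D y <->
  GZC y /\ forall c, c \in D -> kogan_eqn y (val c).1 (val c).2.
Proof.
by split=> -[yG H]; split=> // c /H; apply kogan_functional_eq0.
Qed.

Lemma kogan_face_kface F : kogan_face v F -> exists D, F = kface D.
Proof. by case=> Ff Fv; apply: face_vface Ff Fv. Qed.

Lemma kface_kogan_face D : kogan_face v (kface D).
Proof. by split; [apply: vface_is_face | apply: vface_v]. Qed.

(** For a cell outside [D], the edge point of that cell lies in the face and violates its
    equation. *)
Lemma kogan_diagram_kface D : kogan_diagram (kface D) = val @` [set` D].
Proof.
apply/seteqP; split=> [c [cc H]|_ [c cD <-]]; last first.
  by split=> [|y /kfaceP[_ /(_ _ cD)]]; [exact: (valP c)|].
exists (Sub c cc : gz_cell n) => //=; apply/negPn/negP => cD.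
have /H K : kface D (v + kogan_edge (Sub c cc)) by apply/vface_e.
have := (kogan_functional_eq0 (v + kogan_edge (Sub c cc)) (Sub c cc)).2 K.
by rewrite addrC addKr dual eqxx => /eqP; rewrite oner_eq0.
Qed.

Lemma GZC_P_kface i (d : gz_cell n) : val d = (1, i)%N ->
  GZC_P i = kface [set d]%SET.
Proof.
move=> dE; apply/seteqP; split=> y.
  case=> yi yG; apply/kfaceP; split=> // c; rewrite finset.in_set1 => /eqP ->.
  by rewrite dE /=.
case/kfaceP => yG /(_ d); rewrite finset.in_set1 eqxx dE => /(_ isT) /= H.
by split=> //=.
Qed.

Lemma vertex_notin_Q i : (1 <= i <= n)%N -> ~ GZC_Q i v.
Proof.
move=> i_n [/= vQ _].
have : kogan_eqn v 1 i by apply: vK.2; rewrite mem_gz_cells; lia.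
by rewrite /kogan_eqn /eqnA /= vQ /gz_coord /= /lam => /eqP; rewrite eqr_nat; lia.
Qed.

(** * Mitosis of a Kogan face, for abstract cell lists *)

Section Mitosis.
Variables (i l : nat) (a0 b0 : nat -> nat * nat).
Hypothesis i_n : (1 <= i <= n)%N.
Hypothesis a_cell : forall j, (1 <= j <= l.+1)%N -> a0 j \in gz_cells n.
Hypothesis b_cell : forall j, (1 <= j <= l)%N -> b0 j \in gz_cells n.
Hypothesis a_inj : {in [pred j | 1 <= j <= l.+1]%N &, injective a0}.
Hypothesis b_inj : {in [pred j | 1 <= j <= l]%N &, injective b0}.
Hypothesis ab : forall j k, (1 <= j <= l.+1)%N -> (1 <= k <= l)%N ->
  a0 j != b0 k.
Hypothesis a1 : a0 1%N = (1, i)%N.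
Hypothesis propagate : forall y p, GZC y -> gz_coord y 1 i = lam R n i.+1 ->
  (1 <= p <= l.+1)%N ->
  (forall j, (1 <= j < p)%N -> kogan_eqn y (b0 j).1 (b0 j).2) ->
  forall j, (2 <= j <= p)%N -> kogan_eqn y (a0 j).1 (a0 j).2.
(** Supplies the row [s] at which the witness for [p] separates paths [i] and [i.+1]; a jump at a
    cell of row [s] must fall on [b p], the first missing cell. *)
Hypothesis split_row : forall p, (1 <= p <= l.+1)%N -> exists s,
  [/\ (0 < s <= i.*2)%N, odd s -> (i < n)%N,
  (forall c r, edge n c r -> (2 <= r <= s)%N ->
     (if odd r then c == i else c == i.+1) ->
     exists2 j, (2 <= j <= p)%N & (r, c - r./2)%N = a0 j),
  (forall c r, edge n c r -> (r < s)%N ->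
     (if odd r then c == i.+1 else c == i) ->
     exists2 j, (1 <= j < p)%N & (r, c - r./2)%N = b0 j) &
  (forall c, edge n c s -> (if odd s then c == i.+1 else c == i) ->
     (p <= l)%N /\ (s, c - s./2)%N = b0 p)].

Lemma mitosis_kogan F : kogan_face v F -> kogan_diagram F (1, i)%N ->
  (forall j, (1 <= j <= l)%N -> ~ kogan_diagram F (b0 j)) ->
  admissible (@GZC R n) (@GZC_P R n i) F /\
  Mgeom v i F = [set E | kogan_face v E /\
    two_row_mitosis l a0 b0 (kogan_diagram F) (kogan_diagram E)].
Proof.
move=> /kogan_face_kface[D ->]; rewrite kogan_diagram_kface => -[c0 c0D c0E] bD.
rewrite (GZC_P_kface c0E); split; first exact: admissible_vface.
pose a j : gz_cell n := insubd c0 (a0 j).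
pose b j : gz_cell n := insubd c0 (b0 j).
have aE j : (1 <= j <= l.+1)%N -> val (a j) = a0 j.
  by move=> jl; rewrite insubdK //; exact: a_cell.
have bE j : (1 <= j <= l)%N -> val (b j) = b0 j.
  by move=> jl; rewrite insubdK //; exact: b_cell.
have a1E : a 1%N = c0 by apply: val_inj; rewrite aE // a1 c0E.
suff main D' : Mgeom v i (kface D) (kface D') <->
    two_row_mitosis l a0 b0 (val @` [set` D]) (val @` [set` D']).
  apply/seteqP; split=> [E|E [/kogan_face_kface[D' ->]]].
    move=> EM; have [D' EE] : exists D', E = kface D'.
      by case: EM => G _ [Ef _ _ _ _]; exact: kogan_face_kface.
    move: EM; rewrite EE => /main EM; split; first exact: kface_kogan_face.
    by rewrite kogan_diagram_kface.
  by rewrite kogan_diagram_kface => /main.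
rewrite /Mgeom (GZC_P_kface c0E) geom_mitosis_vface //; last exact: vertex_notin_Q.
pose impl (c : gz_cell n) := forall y, kface D' y -> GZC_Q i y ->
  kogan_eqn y (val c).1 (val c).2.
have implE : kface D' `&` GZC_Q i `<=` kface (D :\ c0) <->
    forall c, c \in D :\ c0 -> impl c.
  split=> [H c cD y yD yQ|H y [yD yQ]].
    by have /kfaceP[_] := H y (conj yD yQ); apply.
  by apply/kfaceP; split=> [|c cD]; [case: yQ | exact: H].
suff cl : [/\ #|D| = #|D'|.+1, a 1%N \notin D' &
    forall c, c \in D :\ a 1%N -> impl c] <->
    two_row_mitosis l a0 b0 (val @` [set` D]) (val @` [set` D']).
  apply: iff_trans cl; rewrite a1E.
  by split=> -[H1 H2 /implE H3]; split.
apply: (@two_row_mitosis_closure _ _ val l a b a0 b0).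
- exact: val_inj.
- exact: aE.
- exact: bE.
- by move=> j k jl kl E; apply: a_inj => //; rewrite -!aE ?E.
- by move=> j k jl kl E; apply: b_inj => //; rewrite -!bE ?E.
- by move=> j k jl kl; rewrite -(inj_eq val_inj) aE // bE // ab.
- by rewrite a1E.
- move=> j jl; apply/negP => bjD; apply: (bD j jl).
  by exists (b j) => //; exact: bE.
- by move=> c cD' y /kfaceP[_ H] _; exact: H.
- move=> p pl bD' j jp y /kfaceP[yG H] [yQ _]; rewrite aE; last by lia.
  apply: (propagate yG yQ pl) => // k kp.
  by rewrite -bE; [apply/H/bD' | lia].
move=> a1D' p pl bD' bp c cimpl.
have jl j : (2 <= j <= p)%N -> (1 <= j <= l.+1)%N by lia.
have jl' j : (1 <= j < p)%N -> (1 <= j <= l)%N by lia.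
have [s [s_i s_odd W1 W2 W3]] := split_row pl.
(* The witness whose free cells are those outside [D'] lies in [kface D'] and in Q, so the implied
   equation of [c] holds at it and [witness_free] locates [c]. *)
pose L := [seq val c | c <- enum (~: D')].
have LE (d : gz_cell n) : (val d \in L) = (d \notin D').
  by rewrite mem_map ?mem_enum ?inE //; exact: val_inj.
pose y := mkpt R n (witness n i s L).
have i_n' : (i <= n)%N by lia.
have s_i' : (s <= i.*2)%N by lia.
have s_gt0 : (0 < i)%N -> (0 < s)%N by lia.
have yG : GZC y by exact: witness_GZC.
have yE := kogan_eqn_witness R L n0 i_n' s_i' s_odd s_gt0.
have [cD'|cD'] := boolP (c \in D'); [by left | right].
have [k kr cE] := gz_cellE c.
have ceq : kogan_eqn y (val c).1 (val c).2.
  apply: cimpl; last by split=> //; apply: witness_Q => //; lia.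
  apply/kfaceP; split=> // d dD'; have [m mr dE] := gz_cellE d.
  rewrite [in X in kogan_eqn _ _ X]dE /=; apply/yE => //.
  apply: witness_frozen => //.
  - by rewrite -dE LE dD'.
  (* The drop of path [i] at row 1 is the cell [a 1], which is outside [D']; the jump at row [s],
     treated next, is [b p], also outside [D']. *)
  - apply/negP => /andP[/eqP mi /eqP r1]; move: dD'.
    suff -> : d = a 1%N by apply/negP.
    by apply: val_inj; rewrite aE // a1 dE r1 mi subn0.
  - apply/negP => /andP[/eqP rs mi].
    have [|pl' dE'] := W3 m _ mi; first by rewrite -rs.
    case: bp => [pE|/negP]; first by rewrite pE ltnn in pl'.
    apply; suff -> : b p = d by [].
    by apply: val_inj; rewrite bE ?pl' ?andbT; [rewrite dE rs dE'|case/andP: pl].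
rewrite [in X in kogan_eqn _ _ X]cE /= in ceq; move: ceq => /(yE _ _ kr) ceq.
have cL : ((val c).1, k - (val c).1./2)%N \in L by rewrite -cE LE.
have := witness_free _ _ _ _ _ kr cL ceq.
case=> // /orP[/andP[rs ki]|/andP[rs ki]].
  have [j jp jE] := W1 _ _ kr rs ki; exists j => //.
  by apply: val_inj; rewrite cE jE aE //; exact: jl.
have [j jp jE] := W2 _ _ kr rs ki.
case/negP: cD'; suff -> : c = b j by exact: bD'.
by apply: val_inj; rewrite cE jE bE //; exact: jl'.
Qed.

End Mitosis.
End KoganFaces.

(** * Equations forced by y^1_i = lam (i+1) *)

Section Propagation.
Variables (R : realType) (n i : nat) (y : gz_space R n).
Hypothesis yG : GZC y.
Hypothesis yQ : gz_coord y 1 i = lam R n i.+1.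

Let lev1 : lev y i 1 = lam R n i.+1.
Proof. by rewrite -yQ /lev subn0. Qed.

(** Each b-equation carries the value [lam i.+1] one row down; the coordinate of the next a-cell is
    then squeezed between two coordinates of the previous row with that value. *)
Lemma propagate_two_paths p : (1 <= i < n)%N -> (1 <= p <= i.*2)%N ->
  (forall j, (1 <= j < p)%N ->
     let c := if odd j then i.+1 else i in lev y c j = lev y c j.-1) ->
  forall j, (2 <= j <= p)%N ->
     let c := if odd j then i else i.+1 in lev y c j = lev y c j.-1.
Proof.
move=> i_n pi bE.
have inv j : (1 <= j <= p)%N ->
    lev y (if odd j then i else i.+1) j = lam R n i.+1 /\
    lev y (if odd j then i.+1 else i) j.-1 = lam R n i.+1.
  elim: j => // -[_ _|j IH jp]; first by rewrite /= lev0.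
  have [|IH1 IH2] := IH; first by lia.
  have := bE j.+1; rewrite /= in IH1 IH2 *.
  case: (boolP (odd j)) IH1 IH2 => jo /= IH1 IH2.
    move=> bj.
    have e : edge n i j.+2 by rewrite /edge; lia.
    have /= := (GZC_lev y).1 yG _ _ e; rewrite negbK jo => -[].
    rewrite IH1 bj ?IH2; last by lia.
    by move=> h1 h2; split=> //; apply/eqP; rewrite eq_le h1 h2.
  move=> bj.
  have e : edge n i.+1 j.+2 by rewrite /edge; lia.
  have /= := (GZC_lev y).1 yG _ _ e; rewrite negbK (negbTE jo) => -[].
  rewrite IH1 bj ?IH2; last by lia.
  by move=> h1 h2; split=> //; apply/eqP; rewrite eq_le h1 h2.
move=> j jp /=; have [] := inv j; first by lia.
move=> -> _; case: j jp => [|j] // jp; have [] := inv j; first by lia.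
have := bE j; rewrite /=; case: (odd j) => /= bj _ jE.
  by rewrite bj ?jE //; lia.
by rewrite bj ?jE //; lia.
Qed.

(** Here the common value is [lam n.+1 = 0], and the constant zeros at the end of the even rows play
    the part of path [i.+1]. *)
Lemma propagate_last_path p : (1 <= i)%N -> i = n -> (1 <= p <= n)%N ->
  (forall j, (1 <= j < p)%N -> lev y n j.*2 = lev y n j.*2.-1) ->
  forall j, (2 <= j <= p)%N -> lev y n j.*2.-1 = lev y n j.*2.-2.
Proof.
move=> i1 i_n pn bE; have lam0 : lam R n n.+1 = 0 by rewrite /lam subnn.
have inv j : (1 <= j <= p)%N -> lev y n j.*2.-1 = 0.
  elim: j => // -[_ _|j IH jp]; first by rewrite -[X in lev _ X]i_n lev1 i_n.
  have e : edge n n j.+2.*2.-1 by rewrite /edge; lia.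
  have := (GZC_lev y).1 yG _ _ e; have -> : odd j.+2.*2.-1 by lia.
  have -> : j.+2.*2.-1.-1 = j.+1.*2 by lia.
  rewrite bE ?IH; try lia.
  have -> : lev y n.+1 j.+1.*2 = 0.
    rewrite /lev /gz_coord insubF // mem_gz_cells; lia.
  by move=> -[h1 h2]; apply/eqP; rewrite eq_le h1 h2.
case=> // j jp; rewrite inv; last by lia.
have -> : j.+1.*2.-2 = j.*2 by lia.
by rewrite bE ?inv //; lia.
Qed.

End Propagation.

Local Close Scope ring_scope.

(** * The cell lists of the two cases *)

Theorem theorem4p7 (R : realType) (n : nat) (n_ge1 : (1 <= n)%N)
    (v : gz_space R n) (vK : kogan_vertex v)
    (F : set (gz_space R n)) (FK : kogan_face v F) :
  (forall i : nat, (1 <= i <= n - 1)%N ->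
     kogan_diagram F (1, i)%N ->
     (forall k : nat, (k <= i)%N ->
        ~ kogan_diagram F (2 * k + 1, i - k + 1)%N) ->
     (forall k : nat, (k <= i)%N ->
        ~ kogan_diagram F (2 * k, i - k)%N) ->
     admissible (@GZC R n) (@GZC_P R n i) F /\
     Mgeom v i F =
       [set E | kogan_face v E /\
                MC n (n - i + 1) (kogan_diagram F) (kogan_diagram E)])
  /\
  (kogan_diagram F (1, n)%N ->
   (forall k : nat, (k <= n)%N -> ~ kogan_diagram F (2 * k, n - k)%N) ->
   admissible (@GZC R n) (@GZC_P R n n) F /\
   Mgeom v n F =
     [set E | kogan_face v E /\
              MC n 1 (kogan_diagram F) (kogan_diagram E)]).
Proof.
split=> [i i_n F1 Fodd Feven|F1 Feven]; rewrite /MC.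
  have -> : (n - i + 1 == 1)%N = false by lia.
  have -> : (n.+1 - (n - i + 1) = i)%N by lia.
  rewrite /MCi; apply: mitosis_kogan => //.
  - by lia.
  - by move=> j jl; rewrite mem_gz_cells; lia.
  - by move=> j jl; rewrite mem_gz_cells; case: ifPn; lia.
  - by move=> j k _ _ [].
  - by move=> j k _ _ [].
  - move=> j k jl kl; rewrite xpair_eqE; case: (j =P k) => //= <-.
    by case: ifPn; lia.
  - by congr pair; lia.
  - move=> y p yG yQ pl bE j jp /=.
    have i_n' : (1 <= i < n)%N by lia.
    have pi : (1 <= p <= i.*2)%N by lia.
    have bE' k : (1 <= k < p)%N -> let c := if odd k then i.+1 else i in
        lev y c k = lev y c k.-1.
      move=> kp /=; have := bE k kp => /=.
      have e : edge n (if odd k then i.+1 else i) k.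
        by rewrite /edge; case: ifPn; lia.
      rewrite -(kogan_eqn_lev y e).
      suff -> : ((if odd k then i - uphalf k + 2 else i - uphalf k) =
                (if odd k then i.+1 else i) - k./2)%N by [].
      by case: ifPn; lia.
    have := propagate_two_paths yG yQ i_n' pi bE' jp => /=.
    have e : edge n (if odd j then i else i.+1) j.
      by rewrite /edge; case: ifPn; lia.
    rewrite -(kogan_eqn_lev y e).
    suff -> : (i - uphalf j + 1 = (if odd j then i else i.+1) - j./2)%N by [].
    by case: ifPn; lia.
  (* Both [a_j] and [b_j] lie in row j, so the paths separate at row [p]; for [p = i.*2] path [i]
     has no edge in that row. *)
  - move=> p pl; exists p; split.
    + by lia.
    + by lia.
    + move=> c r; rewrite /edge => e rp cE; exists r => //; congr pair.
      by case: ifPn cE; lia.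
    + move=> c r; rewrite /edge => e rp cE; exists r; first by lia.
      by congr pair; case: ifPn cE; lia.
    + move=> c; rewrite /edge => e cE; split; first by case: ifPn cE; lia.
      by congr pair; case: ifPn cE; lia.
  - move=> j jl; case: ifPn => jo.
      have -> : (j, i - uphalf j + 2)%N = (2 * j./2 + 1, i - j./2 + 1)%N.
        by congr pair; lia.
      by apply: Fodd; lia.
    have -> : (j, i - uphalf j)%N = (2 * j./2, i - j./2)%N by congr pair; lia.
    by apply: Feven; lia.
rewrite eqxx /MC1; apply: mitosis_kogan => //.
- by lia.
- by move=> j jl; rewrite mem_gz_cells; lia.
- by move=> j jl; rewrite mem_gz_cells; lia.
- by move=> j k; rewrite !inE => jl kl [] ? ?; lia.
- by move=> j k; rewrite !inE => jl kl [] ? ?; lia.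
- by move=> j k jl kl; rewrite xpair_eqE; lia.
- by congr pair; lia.
- move=> y p yG yQ pl bE j jp /=.
  have pn : (1 <= p <= n)%N by lia.
  have bE' k : (1 <= k < p)%N -> lev y n k.*2 = lev y n k.*2.-1.
    move=> kp; have := bE k kp => /=.
    have e : edge n n k.*2 by rewrite /edge; lia.
    by rewrite -(kogan_eqn_lev y e) doubleK.
  have := propagate_last_path yG yQ n_ge1 erefl pn bE' jp.
  have e : edge n n j.*2.-1 by rewrite /edge; lia.
  rewrite -(kogan_eqn_lev y e).
  by have -> : (n - j.*2.-1./2 = n - j + 1)%N by lia.
(* Now [b_p] lies in row 2p, hence [s = p.*2]; for [p = n] this row is beyond the end of path
   [n]. *)
- move=> p pl; exists p.*2; split.
  + by lia.
  + by lia.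
  + move=> c r; rewrite /edge => e rp cE; exists (uphalf r).
      by case: ifPn cE; lia.
    by congr pair; case: ifPn cE; lia.
  + move=> c r; rewrite /edge => e rp cE; exists r./2.
      by case: ifPn cE; lia.
    by congr pair; case: ifPn cE; lia.
  + move=> c; rewrite /edge odd_double => e cE; split; first by lia.
    by congr pair; lia.
- move=> j jl; have -> : (j.*2, n - j)%N = (2 * j, n - j)%N by congr pair; lia.
  by apply: Feven; lia.
Qed.
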